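(* Each of the six classes $\mathbb D$, $\mathbb D'$, $\mathbb I$, $\mathbb I'$, $\mathbb N$, $\mathbb N'$ of generating spaces is productive.
   Context: For a poset $P$ and $\infty\notin P$, with $\uparrow x=\{y\in P:x\le y\}$ for $x\in P$: $\beta_P$ is the topology on $P\cup\{\infty\}$ with subbase all $\uparrow x$ and $\uparrow x\cup\{\infty\}$, $x\in P$; $\gamma_P$ is the topology on $P\cup\{\infty\}$ with subbase all $\uparrow x\cup\{\infty\}$, $x\in P$. Directed posets and chains are non-empty; $N$ is the poset of natural numbers with its usual order. The six classes are: $\mathbb D=\{(D\cup\{\infty\},\beta_D): D$ a directed poset$\}$; $\mathbb D'=\{(D\cup\{\infty\},\gamma_D): D$ a directed poset with no largest element$\}$; $\mathbb I=\{(I\cup\{\infty\},\beta_I): I$ a chain$\}$; $\mathbb I'=\{(I\cup\{\infty\},\gamma_I): I$ a chain with no largest element$\}$; $\mathbb N=\{(N\cup\{\infty\},\beta_N)\}$; $\mathbb N'=\{(N\cup\{\infty\},\gamma_N)\}$. For a class $\mathbb C$ of $T_0$ spaces, a subset $U$ of a $T_0$ space $X$ is $\mathbb C$-open if $k^{-1}(U)$ is open in $C$ for every $C\in\mathbb C$ and every continuous map $k:C\to X$; $X$ is $\mathbb C$-generated if every $\mathbb C$-open subset is open. A space $X$ is core compact if for every open $V$ and $x\in V$ there is an open $U$ with $x\in U\ll V$, where $U\ll V$ means that every open cover of $V$ has a finite subfamily covering $U$. $\mathbb C$ is productive if every space in $\mathbb C$ is core compact and every topological product $C_1\times C_2$ with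 $C_1,C_2\in\mathbb C$ is $\mathbb C$-generated. *)

(* Defs.v *)
From HB Require Import structures.
From mathcomp Require Import all_boot all_order.
From mathcomp Require Import all_classical topology.

Set Implicit Arguments.
Unset Strict Implicit.
Unset Printing Implicit Defensive.

Import Order.TTheory.
Local Open Scope classical_set_scope.
Local Open Scope order_scope.

Section Subbases.
Context (d : Order.disp_t) (P : porderType d).

(* In [option P], [Some] is the inclusion of P and [None] is the point oo. *)
Definition up (x : P) : set (option P) := Some @` [set y | x <= y].

Definition up_oo (x : P) : set (option P) := up x `|` [set None].

Definition beta_subbase : set (set (option P)) := range up `|` range up_oo.

Definition gamma_subbase : set (set (option P)) := range up_oo.

End Subbases.

(* Two aliases of [option P], so that each carries its own topology. *)
Definition beta_space (d : Order.disp_t) (P : porderType d) : Type := option P.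
Definition gamma_space (d : Order.disp_t) (P : porderType d) : Type := option P.

HB.instance Definition _ (d : Order.disp_t) (P : porderType d) :=
  Choice.copy (beta_space P) (option P).
HB.instance Definition _ (d : Order.disp_t) (P : porderType d) :=
  isSubBaseTopological.Build (beta_space P) (@beta_subbase d P) id.

HB.instance Definition _ (d : Order.disp_t) (P : porderType d) :=
  Choice.copy (gamma_space P) (option P).
HB.instance Definition _ (d : Order.disp_t) (P : porderType d) :=
  isSubBaseTopological.Build (gamma_space P) (@gamma_subbase d P) id.

Definition directed_poset (d : Order.disp_t) (P : porderType d) : Prop :=
  inhabited P /\ forall x y : P, exists z : P, x <= z /\ y <= z.

Definition has_largest (d : Order.disp_t) (P : porderType d) : Prop :=
  exists m : P, forall x : P, x <= m.

Definition space_class := topologicalType -> Prop.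

Inductive class_D : space_class :=
  Class_D (d : Order.disp_t) (D : porderType d) of directed_poset D :
    class_D (beta_space D).

Inductive class_D' : space_class :=
  Class_D' (d : Order.disp_t) (D : porderType d)
    of directed_poset D & ~ has_largest D : class_D' (gamma_space D).

(* A chain is a non-empty totally ordered set. *)
Inductive class_I : space_class :=
  Class_I (d : Order.disp_t) (I : orderType d) of inhabited I :
    class_I (beta_space I).

Inductive class_I' : space_class :=
  Class_I' (d : Order.disp_t) (I : orderType d)
    of inhabited I & ~ has_largest I : class_I' (gamma_space I).

Inductive class_N : space_class := Class_N : class_N (beta_space nat).

Inductive class_N' : space_class := Class_N' : class_N' (gamma_space nat).

Definition class_open (CC : space_class) (X : topologicalType) (U : set X) :
    Prop :=
  forall C : topologicalType, CC C ->
  forall k : C -> X, continuous k -> open (k @^-1` U).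

Definition class_generated (CC : space_class) (X : topologicalType) : Prop :=
  forall U : set X, class_open CC U -> open U.

Definition way_below (X : topologicalType) (U V : set X) : Prop :=
  forall F : set (set X), F `<=` open -> V `<=` \bigcup_(W in F) W ->
  exists G : set (set X),
    [/\ finite_set G, G `<=` F & U `<=` \bigcup_(W in G) W].

Definition core_compact (X : topologicalType) : Prop :=
  forall (V : set X) (x : X), open V -> V x ->
  exists U : set X, [/\ open U, U x & way_below U V].

(* Productivity is a notion about classes of T0 spaces only: the first clause
   is the condition on CC under which it is defined. *)
Definition productive (CC : space_class) : Prop :=
  [/\ forall C : topologicalType, CC C -> kolmogorov_space C,
      forall C : topologicalType, CC C -> core_compact C &
      forall C1 C2 : topologicalType, CC C1 -> CC C2 ->
        class_generated CC (C1 * C2)%type].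

(* Main.v *)
Require Import Defs.
From mathcomp Require Import all_boot all_order.
From mathcomp Require Import all_classical topology.

Set Implicit Arguments.
Unset Strict Implicit.
Unset Printing Implicit Defensive.

Import Order.TTheory.
Local Open Scope classical_set_scope.
Local Open Scope order_scope.

(** Call z above x when every open set containing x contains z.  All the
    generating spaces share one local feature, [tethered] below: inside any
    open set V around a point c lies some point x such that c together with
    the points above x already forms a neighborhood of c.  At a point c of the
    poset one takes x = c; at oo any x of the poset lying in V will do, as
    [up_oo x] is a neighborhood of oo, and there is one because the poset is
    directed ([tail_in_open]).

    A tethered space is core compact because a cover of V covers the
    neighborhood above with two members, one through c and one through x
    ([tethered_core_compact]).  It also makes separate openness imply joint
    openness ([open_of_slices]): from a point (a, b) of U one moves first a and
    then b to points x and y, and since open slices are closed under passing to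
    points above, U contains a whole rectangle around (a, b).  Finally, if C1
    and C2 belong to the class, the slices of a class-open subset of C1 * C2
    are open, since c |-> (c, b) and c |-> (a, c) are continuous maps from
    spaces of the class; hence class-open sets are open ([tethered_productive]).
    No map defined on a product of posets is involved, which is why the argument
    covers chains, whose products are not chains, as well as directed posets. *)

(** * Tethered spaces *)

Definition saturation (X : topologicalType) (x : X) : set X :=
  \bigcap_(O in open_nbhs x) O.

Definition tethered (X : topologicalType) : Prop :=
  forall (c : X) (V : set X), open V -> V c ->
  exists2 x, V x & nbhs c (c |` saturation x).

Lemma saturation_open (X : topologicalType) (x z : X) (O : set X) :
  open O -> O x -> saturation x z -> O z.
Proof. by move=> oO Ox; apply. Qed.

Lemma tethered_core_compact (X : topologicalType) :
  tethered X -> core_compact X.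
Proof.
move=> tX V c oV Vc; have [x Vx nc] := tX c V oV Vc.
exists (c |` saturation x)°; split=> //; first exact: open_interior.
move=> F Fop VF.
have [W FW Wc] := VF _ Vc; have [W' FW' W'x] := VF _ Vx.
exists [set W; W']; split; first exact: finite_set2.
  by move=> _ [->|->].
move=> z /interior_subset [->|xz]; first by exists W => //; left.
by exists W'; [right|apply: saturation_open xz => //; exact: Fop].
Qed.

(** The rectangle found around (a, b) is the union of four pieces: the point
    (a, b), the part of the slice through a above y, the part of the slice
    through b above x, and the points above (x, y).  Choosing y after x, in the
    intersection of the slices through a and x, makes all four lie in U. *)
Lemma open_of_slices (X Y : topologicalType) (U : set (X * Y)) :
    tethered X -> tethered Y ->
    (forall y, open [set x | U (x, y)]) ->
    (forall x, open [set y | U (x, y)]) ->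
  open U.
Proof.
move=> tX tY oX oY; rewrite openE => -[a b] Uab.
have [x Uxb na] := tX a _ (oX b) Uab.
have [y [Uay Uxy] nb] := tY b _ (openI (oY a) (oY x)) (conj Uab Uxb).
exists (a |` saturation x, b |` saturation y) => // -[x' y'] /= [].
move=> [->|xx'] [->|yy'] //.
- exact: saturation_open (oY a) Uay yy'.
- exact: saturation_open (oX b) Uxb xx'.
- have Ux'y : U (x', y) by exact: saturation_open (oX y) Uxy xx'.
  exact: saturation_open (oY x') Ux'y yy'.
Qed.

Lemma tethered_productive (CC : space_class) :
    (forall C, CC C -> kolmogorov_space C) ->
    (forall C, CC C -> tethered C) ->
  productive CC.
Proof.
move=> T0 tC; split=> // [C /tC|C1 C2 CC1 CC2 U oU].
  exact: tethered_core_compact.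
apply: open_of_slices => [||y|x]; [exact: tC|exact: tC| |].
- by apply: (oU _ CC1 (pair^~ y)) => c; apply: cvg_pair; [|exact: cvg_cst].
- by apply: (oU _ CC2 (pair x)) => c; apply: cvg_pair; [exact: cvg_cst|].
Qed.

Lemma T0_of_open (X : topologicalType) :
    (forall x y : X, x != y ->
      exists2 O, open O & (O x /\ ~ O y) \/ (O y /\ ~ O x)) ->
  kolmogorov_space X.
Proof.
move=> h x y /h[O oO [] [Ox Oy]]; exists O; [left|right];
  by split; rewrite inE //; apply/open_nbhs_nbhs.
Qed.

(** * Topologies given by a subbase *)

Section Subbase.
Context {T : choiceType} (D : set (set T)).

(** The shape to which openness unfolds in a topology generated by the
    subbase D; it is stated on a bare type so as to serve both topologies on
    [option P]. *)
Definition subbase_open (V : set T) : Prop :=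
  [set \bigcup_(B in E) B | E in subset^~ (finI_from D id)] V.

Lemma subbase_open1 (B : set T) : D B -> subbase_open B.
Proof.
move=> DB; exists [set B]; last by rewrite bigcup_set1.
by move=> _ ->; exact: (finI_from1 id).
Qed.

(** The neighborhoods of p form the least filter containing the subbasic sets
    around p.  Applied to
    the principal filter at q it compares p with q ([subbase_above]); applied to
    the tails of a directed poset it describes the neighborhoods of oo
    ([tail_in_open]). *)
Lemma subbase_filter (F : set_system T) (p : T) (V : set T) : Filter F ->
  (forall B, D B -> B p -> F B) -> subbase_open V -> V p -> F V.
Proof.
move=> FF DF [E ED <-] [B EB Bp].
have [G GD BE] := ED _ EB; apply: (@filterS _ F _ B); first by exists B.
rewrite -BE in Bp *; apply: filter_bigI => A GA.
by apply: DF; [exact/set_mem/GD|exact: Bp].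
Qed.

Lemma subbase_above (p q : T) (V : set T) :
  (forall B, D B -> B p -> B q) -> subbase_open V -> V p -> V q.
Proof.
move=> pq oV Vp; have FV : globally [set q] V; last exact: FV.
by apply: subbase_filter oV Vp => B DB Bp _ ->; exact: pq.
Qed.

End Subbase.

(** * The generating spaces *)

Section Generating.
Context (d : Order.disp_t) (P : porderType d).
Implicit Types (x y : P) (V : set (option P)).

Lemma up_Some x y : up x (Some y) = (x <= y) :> Prop.
Proof. by apply/propext; split=> [[z xz [<-]]|xy] //; exists y. Qed.

Lemma up_None x : ~ up x None.
Proof. by case. Qed.

Lemma up_oo_Some x y : up_oo x (Some y) = (x <= y) :> Prop.
Proof.
by rewrite -up_Some; apply/propext; split=> [[//|//]|?]; left.
Qed.

Lemma beta_mono x y V :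
  subbase_open (@beta_subbase d P) V -> x <= y -> V (Some x) -> V (Some y).
Proof.
move=> oV xy; apply: subbase_above oV => B [] [z _ <-].
  by rewrite !up_Some => /le_trans; apply.
by rewrite !up_oo_Some => /le_trans; apply.
Qed.

Lemma gamma_mono x y V :
  subbase_open (@gamma_subbase d P) V -> x <= y -> V (Some x) -> V (Some y).
Proof.
move=> oV xy; apply: subbase_above oV => B [z _ <-].
by rewrite !up_oo_Some => /le_trans; apply.
Qed.

Lemma gamma_oo x V :
  subbase_open (@gamma_subbase d P) V -> V (Some x) -> V None.
Proof. by move=> oV; apply: subbase_above oV => B [z _ <-] _; right. Qed.

(** The only use of directedness: the tails of P form a filter, to which every
    subbasic set containing oo belongs. *)
Lemma tail_in_open (D : set (set (option P))) V : directed_poset P ->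
    (forall B, D B -> B None -> exists x, B = up_oo x) ->
  subbase_open D V -> V None -> exists x, V (Some x).
Proof.
move=> [[x0] dirP] Doo oV Voo.
pose F := filter_from setT (fun x => Some @` [set y | x <= y]).
have FF : Filter F.
  apply: filter_from_filter; first by exists x0.
  move=> x y _ _; have [z [xz yz]] := dirP x y; exists z => //.
  by move=> _ [w zw <-]; split; exists w => //; exact: le_trans zw.
have [|x _ xV] := @subbase_filter _ D F None V FF _ oV Voo.
  by move=> B /Doo/[apply] -[x ->]; exists x => // w; left.
by exists x; apply: xV; exists x => /=.
Qed.

Lemma beta_tethered : directed_poset P -> tethered (beta_space P).
Proof.
move=> dirP.
have sat x : up x `<=` saturation (Some x : beta_space P).
  move=> _ [y xy <-] O [oO Ox]; exact: beta_mono oO xy Ox.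
case=> [x|] V oV Vc.
  exists (Some x) => //; rewrite nbhsE; exists (up x).
    by split; [apply: subbase_open1; left; exists x|rewrite up_Some].
  by move=> z /sat; right.
have [x Vx] : exists x, V (Some x).
  apply: (tail_in_open dirP _ oV Vc) => B [] [z _ <-]; last by exists z.
  by move=> /up_None.
exists (Some x) => //; rewrite nbhsE; exists (up_oo x).
  by split; [apply: subbase_open1; right; exists x|right].
by move=> z [/sat|->]; [right|left].
Qed.

Lemma gamma_tethered : directed_poset P -> tethered (gamma_space P).
Proof.
move=> dirP.
have sat x : up_oo x `<=` saturation (Some x : gamma_space P).
  by move=> _ [[y xy <-]|->] O [oO Ox];
    [exact: gamma_mono oO xy Ox|exact: gamma_oo oO Ox].
have nbhs_up_oo x c : up_oo x c ->
    nbhs (c : gamma_space P) (c |` saturation (Some x : gamma_space P)).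
  move=> xc; rewrite nbhsE; exists (up_oo x); last by move=> z /sat; right.
  by split; [apply: subbase_open1; exists x|].
case=> [x|] V oV Vc.
  by exists (Some x) => //; apply: nbhs_up_oo; rewrite up_oo_Some.
have [x Vx] : exists x, V (Some x).
  by apply: (tail_in_open dirP _ oV Vc) => B [z _ <-]; exists z.
by exists (Some x) => //; apply: nbhs_up_oo; right.
Qed.

Lemma beta_T0 : kolmogorov_space (beta_space P).
Proof.
have oup x : open (up x : set (beta_space P)).
  by apply: subbase_open1; left; exists x.
apply: T0_of_open => -[x|] [y|] // xy; last 2 first.
- by exists (up x) => //; left; rewrite up_Some; split=> // /up_None.
- by exists (up y) => //; right; rewrite up_Some; split=> // /up_None.
have [xley|nxy] := boolP (x <= y); last first.
  by exists (up x) => //; left; rewrite !up_Some; split=> //; exact/negP.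
exists (up y) => //; right; rewrite !up_Some; split=> // ylex.
by case/eqP: xy; congr Some; apply/le_anti/andP.
Qed.

(** A largest element would lie in the same open sets as oo. *)
Lemma gamma_T0 : ~ has_largest P -> kolmogorov_space (gamma_space P).
Proof.
move=> nolargest.
have oup x : open (up_oo x : set (gamma_space P)).
  by apply: subbase_open1; exists x.
have above x : exists z, ~ (z <= x).
  apply: contra_notP nolargest => /forallNP H.
  by exists x => z; exact: contrapT (H z).
apply: T0_of_open => -[x|] [y|] // xy; last 2 first.
- have [z zx] := above x.
  by exists (up_oo z) => //; right; rewrite up_oo_Some; split=> //; right.
- have [z zy] := above y.
  by exists (up_oo z) => //; left; rewrite up_oo_Some; split=> //; right.
have [xley|nxy] := boolP (x <= y); last first.
  by exists (up_oo x) => //; left; rewrite !up_oo_Some; split=> //; exact/negP.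
exists (up_oo y) => //; right; rewrite !up_oo_Some; split=> // ylex.
by case/eqP: xy; congr Some; apply/le_anti/andP.
Qed.

End Generating.

Lemma chain_directed (d : Order.disp_t) (I : orderType d) :
  inhabited I -> directed_poset I.
Proof.
move=> I0; split=> // x y; exists (Order.max x y).
by split; rewrite le_max lexx ?orbT.
Qed.

Lemma nat_no_largest : ~ has_largest nat.
Proof. by case=> m /(_ m.+1); rewrite leEnat ltnn. Qed.

Theorem proposition35 :
  productive class_D /\ productive class_D' /\
  productive class_I /\ productive class_I' /\
  productive class_N /\ productive class_N'.
Proof.
have nat0 : inhabited nat := inhabits 0%N.
split; [|split; [|split; [|split; [|split]]]]; apply: tethered_productive => C.
- by case=> *; exact: beta_T0.
- by case=> *; exact: beta_tethered.
- by case=> *; exact: gamma_T0.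
- by case=> *; exact: gamma_tethered.
- by case=> *; exact: beta_T0.
- by case=> *; apply/beta_tethered/chain_directed.
- by case=> *; exact: gamma_T0.
- by case=> *; apply/gamma_tethered/chain_directed.
- by case; exact: beta_T0.
- by case; apply/beta_tethered/chain_directed.
- by case; apply/gamma_T0/nat_no_largest.
- by case; apply/gamma_tethered/chain_directed.
Qed.
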